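(* There is a computable function $f$ which is a computable reduction of $=^{ce}$ to itself such that whenever $W_i\neq W_j$, the sets $W_{f(i)}$ and $W_{f(j)}$ are not computably isomorphic. In particular, $f$ is a computable reduction of $=^{ce}$ to $R^{ce}_G$ for every computable subgroup $G$ of $S_\infty$.
   Context: $(W_e)_{e\in\omega}$ is a standard uniform enumeration of the c.e.\ subsets of $\omega$. $i=^{ce}j\iff W_i=W_j$. A computable reduction of an equivalence relation $E$ on $\omega$ to $F$ is a computable $f$ with $x\,E\,y\iff f(x)\,F\,f(y)$. Two sets $A,B\subseteq\omega$ are computably isomorphic if there is a computable permutation $p$ of $\omega$ with $p[A]=B$. A computable subgroup of $S_\infty$ is a computable group acting computably by permutations on $\omega$; for such $G$, $i\,R^{ce}_G\,j\iff(\exists\gamma\in G)(W_i=\{\gamma(x):x\in W_j\})$. *)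

(* Defs.v *)
From mathcomp Require Import all_boot.
From mathcomp Require Import boolp classical_sets.

Set Implicit Arguments.
Unset Strict Implicit.
Unset Printing Implicit Defensive.

Local Open Scope classical_set_scope.

(* Kleene's mu-recursive functions, indexed by arity. *)
Inductive recfun : nat -> Type :=
| Zero n : recfun n
| Succ : recfun 1
| Proj n (i : 'I_n) : recfun n
| Comp m n (f : recfun m) (g : 'I_m -> recfun n) : recfun n
| Prec n (f : recfun n) (g : recfun n.+2) : recfun n.+1
| Mu n (f : recfun n.+1) : recfun n.

(* [eval c v y]: the partial function denoted by [c] converges on [v] with
   value [y].  For [Prec], h(0, w) = f(w) and h(k+1, w) = g(k, h(k, w), w).
   For [Mu], the value is the least y with f(y, v) = 0, all the values f(z, v)
   with z < y being required to converge. *)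
Fixpoint eval n (c : recfun n) : n.-tuple nat -> nat -> Prop :=
  match c in recfun n return n.-tuple nat -> nat -> Prop with
  | Zero _ => fun _ y => y = 0
  | Succ => fun v y => y = (thead v).+1
  | Proj _ i => fun v y => y = tnth v i
  | Comp m _ f g => fun v y =>
      exists w : m.-tuple nat,
        (forall i, eval (g i) v (tnth w i)) /\ eval f w y
  | Prec _ f g => fun v y =>
      let w := [tuple of behead v] in
      (fix h (k : nat) (y : nat) : Prop :=
         if k is k'.+1 then
           exists z, h k' z /\ eval g [tuple of k' :: z :: w] y
         else eval f w y) (thead v) y
  | Mu _ f => fun v y =>
      eval f [tuple of y :: v] 0 /\
      forall z, z < y -> exists u, eval f [tuple of z :: v] u.+1
  end.

Definition computable (f : nat -> nat) : Prop :=
  exists c : recfun 1, forall x, eval c [tuple x] (f x).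

Definition computable2 (f : nat -> nat -> nat) : Prop :=
  exists c : recfun 2, forall x y, eval c [tuple x; y] (f x y).

Definition ce (A : set nat) : Prop :=
  exists c : recfun 1, forall x, A x <-> exists y, eval c [tuple x] y.

Definition ce2 (V : nat -> set nat) : Prop :=
  exists c : recfun 2, forall e x, V e x <-> exists y, eval c [tuple e; x] y.

(* A standard (acceptable, in the sense of Rogers) numbering of the c.e. sets:
   it is uniformly c.e., and every uniformly c.e. sequence of sets is uniformly
   translated into it (s-m-n property).  That it enumerates exactly the c.e.
   sets is [standard_ceP] below. *)
Record standard_enumeration (W : nat -> set nat) : Prop := {
  standard_uniform : ce2 W;
  standard_smn : forall V, ce2 V ->
    exists2 s, computable s & forall e, W (s e) = V e
}.

Lemma eval_det n (c : recfun n) v y y' : eval c v y -> eval c v y' -> y = y'.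
Proof.
elim: c v y y' => {n} [n||n i|m n f IHf g IHg|n f IHf g IHg|n f IHf] v y y' /=.
- by move=> -> ->.
- by move=> -> ->.
- by move=> -> ->.
- move=> [w [gw fw]] [w' [gw' fw']].
  suff ww' : w = w' by apply: IHf fw _; rewrite ww'.
  by apply: eq_from_tnth => i; apply: IHg (gw i) (gw' i).
- elim: (thead v) y y' => [|k IHk] y y'; first exact: IHf.
  by move=> [z [hz gz]] [z' [hz' gz']]; apply: IHg gz _; rewrite (IHk _ _ hz hz').
- move=> [fy ly] [fy' ly']; case: (ltngtP y y') => // [/ly'|/ly] [u fu].
    by have := IHf _ _ _ fy fu.
  by have := IHf _ _ _ fy' fu.
Qed.

Lemma standard_ceP W : standard_enumeration W ->
  forall A, ce A <-> exists e, W e = A.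
Proof.
move=> [[u Wu] smn] A; split=> [[c Ac]|[e <-]].
- have [|s _ Ws] := smn (fun=> A); last by exists (s 0); rewrite Ws.
  exists (Comp c (fun _ : 'I_1 => Proj (inord 1 : 'I_2))) => e x.
  have px w : (forall i : 'I_1, tnth w i = tnth [tuple e; x] (inord 1)) ->
      w = [tuple x].
    by move=> ew; apply: eq_from_tnth => i; rewrite ew (ord1 i) !(tnth_nth 0) /= inordK.
  rewrite Ac; split=> [[y cy]|[y /= [w [/px -> cy]]]]; exists y => //=.
  exists [tuple x]; split=> // i.
  by rewrite (ord1 i) !(tnth_nth 0) /= inordK.
- pose const := iter e (fun c => Comp Succ (fun _ : 'I_1 => c)) (Zero 1).
  have constP v y : eval const v y <-> y = e.
    rewrite /const; elim: (e) y => //= k IHk y; split.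
      by move=> [w [/(_ ord0)/IHk wk ->]]; rewrite /thead wk.
    move=> ->; exists [tuple k]; split=> [i|//].
    by apply/IHk; rewrite (ord1 i).
  exists (Comp u (fun i : 'I_2 => if i == ord0 then const else Proj ord0)) => x.
  rewrite Wu; split=> [[y uy]|[y /= [w [ew uy]]]]; exists y.
    exists [tuple e; x]; split=> // -[[|[|//]] ltj] /=; last by rewrite !(tnth_nth 0).
    by apply/constP; rewrite (tnth_nth 0).
  suff -> : [tuple e; x] = w by [].
  apply: eq_from_tnth => -[[|[|//]] ltj].
    by have /= /constP -> := ew (Ordinal ltj); rewrite (tnth_nth 0).
  by have /= -> := ew (Ordinal ltj); rewrite !(tnth_nth 0).
Qed.

Definition reduction (E F : nat -> nat -> Prop) (f : nat -> nat) : Prop :=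
  computable f /\ forall x y, E x y <-> F (f x) (f y).

Definition computably_isomorphic (A B : set nat) : Prop :=
  exists p : nat -> nat, [/\ computable p, bijective p & p @` A = B].

Definition eq_ce (W : nat -> set nat) (i j : nat) : Prop := W i = W j.

(* A computable group, with domain a computable subset of nat, together with a
   computable action on nat.  The action need not be faithful. *)
Record computable_subgroup : Type := ComputableSubgroup {
  cg_dom : pred nat;
  cg_one : nat;
  cg_mul : nat -> nat -> nat;
  cg_act : nat -> nat -> nat;
  cg_dom_computable : computable (fun g => cg_dom g : nat);
  cg_mul_computable : computable2 cg_mul;
  cg_act_computable : computable2 cg_act;
  cg_one_dom : cg_dom cg_one;
  cg_mul_dom : forall g h, cg_dom g -> cg_dom h -> cg_dom (cg_mul g h);
  cg_mulA : forall g h k, cg_dom g -> cg_dom h -> cg_dom k ->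
    cg_mul g (cg_mul h k) = cg_mul (cg_mul g h) k;
  cg_mul1 : forall g, cg_dom g -> cg_mul cg_one g = g /\ cg_mul g cg_one = g;
  cg_inv : forall g, cg_dom g -> exists2 h, cg_dom h &
    cg_mul g h = cg_one /\ cg_mul h g = cg_one;
  cg_act1 : forall x, cg_act cg_one x = x;
  cg_actM : forall g h x, cg_dom g -> cg_dom h ->
    cg_act (cg_mul g h) x = cg_act g (cg_act h x)
}.

Lemma cg_act_bij (G : computable_subgroup) g :
  cg_dom G g -> bijective (cg_act G g).
Proof.
move=> Gg; have [h Gh [gh hg]] := cg_inv Gg.
by exists (cg_act G h) => x; rewrite -cg_actM // ?gh ?hg cg_act1.
Qed.

Definition R_ce (W : nat -> set nat) (G : computable_subgroup) (i j : nat) :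
  Prop := exists2 g, cg_dom G g & W i = cg_act G g @` W j.

(* Main.v *)
(* Split the natural numbers into blocks, block j having 3 * 4^j elements (4 if
   j = 0), and let j = <e, n> serve the e-th partial computable function F_e and
   the column n.  Let C consist of the values z = F_e(x), for x in a block
   j = <e, n>, such that z lies neither in column n nor in a block before j, and
   send A to C together with the columns in A.  This is extensional in A and
   uniform.
   Suppose the permutation F_e carries the code of A to the code of B, while n is
   in B but not in A.  In block j = <e, n>, at most 4^j elements belong to C, as
   each is the value of an element of an earlier block, and at most 4^j are sent
   to earlier blocks.  Any other element x of block j is not in the code of A,
   so F_e(x) is not in the code of B; hence F_e(x) is not in column n, and it
   was put into C, a contradiction.  Sparseness thus replaces a priority
   argument. *)

Require Import Defs.
From mathcomp Require Import all_boot.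
From mathcomp Require Import boolp classical_sets.
From mathcomp Require Import zify.

Set Implicit Arguments.
Unset Strict Implicit.
Unset Printing Implicit Defensive.

(** * Total recursive functions *)

(** Arguments are read off a plain list by [nth 0], which spares tuple casts in compositions; only
    lists of length [n] matter. *)
Definition rec n (F : seq nat -> nat) : Prop :=
  exists c : recfun n, forall v : n.-tuple nat, eval c v (F v).

Lemma eq_rec n F F' :
  (forall v, size v = n -> F v = F' v) -> rec n F -> rec n F'.
Proof.
by move=> FF' [c cF]; exists c => v; rewrite -FF' ?size_tuple.
Qed.

Lemma rec_zero n : rec n (fun=> 0).
Proof. by exists (Zero n). Qed.

Lemma rec_var n i : rec n (nth 0 ^~ i).
Proof.
have [ltin|leni] := ltnP i n.
  by exists (Proj (Ordinal ltin)) => v /=; rewrite (tnth_nth 0).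
by exists (Zero n) => v /=; rewrite nth_default // size_tuple.
Qed.

Lemma rec_comp m n F (L : seq nat -> seq nat) :
  rec m F -> (forall v, size v = n -> size (L v) = m) ->
  (forall i, i < m -> rec n (fun v => nth 0 (L v) i)) ->
  rec n (fun v => F (L v)).
Proof.
move=> [c cF] szL recL.
have /choice[g gP] : forall i : 'I_m, exists g : recfun n,
    forall v : n.-tuple nat, eval g v (nth 0 (L v) i).
  by move=> i; apply: recL.
exists (Comp c g) => v /=.
have szm : size (L v) == m by rewrite szL ?size_tuple.
exists (Tuple szm); split=> [i|]; last exact: cF (Tuple szm).
by rewrite (tnth_nth 0).
Qed.

Lemma rec_behead n F : rec n F -> rec n.+1 (fun v => F (behead v)).
Proof.
move=> recF; apply: rec_comp recF _ _ => [v|i _]; first by rewrite size_behead => ->.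
by apply: eq_rec (rec_var _ i.+1) => v _; rewrite nth_behead.
Qed.

Lemma rec_cons n H a : rec n.+1 H -> rec n a -> rec n (fun v => H (a v :: v)).
Proof.
move=> recH reca; apply: (rec_comp (L := fun v => a v :: v)) recH _ _ => [v /= ->//|].
by move=> [|i] _ //=; apply: rec_var.
Qed.

Lemma rec_app1 n F a : rec 1 F -> rec n a -> rec n (fun v => F [:: a v]).
Proof.
by move=> recF reca; apply: (rec_comp (L := fun v => [:: a v])) recF _ _ => // -[].
Qed.

Lemma rec_app2 n F a b :
  rec 2 F -> rec n a -> rec n b -> rec n (fun v => F [:: a v; b v]).
Proof.
move=> recF reca recb.
by apply: (rec_comp (L := fun v => [:: a v; b v])) recF _ _ => // -[|[]].
Qed.

Lemma rec_app3 n F a b c : rec 3 F -> rec n a -> rec n b -> rec n c ->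
  rec n (fun v => F [:: a v; b v; c v]).
Proof.
move=> recF reca recb recc.
by apply: (rec_comp (L := fun v => [:: a v; b v; c v])) recF _ _ => // -[|[|[]]].
Qed.

Lemma rec_nat_rect n F (G : nat -> nat -> seq nat -> nat) K :
  rec n F -> rec n.+2 (fun w => G (nth 0 w 0) (nth 0 w 1) (behead (behead w))) ->
  rec n K ->
  rec n (fun v => nat_rect (fun=> nat) (F v) (fun k r => G k r v) (K v)).
Proof.
move=> [cF cFP] [cG cGP].
(* [Prec] recurses on its first argument, so the recursion is built on a fresh head variable, for
   which [rec_cons] substitutes [K]. *)
pose H w := nat_rect (fun=> nat) (F (behead w))
  (fun k r => G k r (behead w)) (head 0 w).
apply: (@rec_cons n H); exists (Prec cF cG) => v /=.
have -> : H v = nat_rect (fun=> nat) (F (behead v))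
    (fun k r => G k r (behead v)) (thead v).
  by rewrite /H /thead (tnth_nth 0) nth0.
elim: (thead v) => [|k IHk] /=; first exact: cFP [tuple of behead v].
set r := nat_rect _ _ _ _ in IHk *; exists r; split=> //.
Qed.

Lemma rec_succ n a : rec n a -> rec n (fun v => (a v).+1).
Proof.
apply: (@rec_app1 n (fun v => (nth 0 v 0).+1)).
by exists Succ => v /=; rewrite /thead (tnth_nth 0).
Qed.

Lemma rec_const n k : rec n (fun=> k).
Proof. by elim: k => [|k IHk]; [apply: rec_zero|apply: rec_succ]. Qed.

Lemma rec_add n a b : rec n a -> rec n b -> rec n (fun v => a v + b v).
Proof.
move=> reca recb.
have recS : rec n.+2 (fun w => (nth 0 w 1).+1) by apply/rec_succ/rec_var.
apply: eq_rec (rec_nat_rect (G := fun _ r _ => r.+1) reca recS recb) => v _.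
by elim: (b v) => [|k /= ->]; rewrite ?addn0 ?addnS.
Qed.

Lemma rec_mul n a b : rec n a -> rec n b -> rec n (fun v => a v * b v).
Proof.
move=> reca recb.
have recS : rec n.+2 (fun w => nth 0 w 1 + a (behead (behead w))).
  exact: rec_add (rec_var _ 1) (rec_behead (rec_behead reca)).
apply: eq_rec (rec_nat_rect (G := fun _ r v => r + a v) (rec_zero n) recS recb).
by move=> v _; elim: (b v) => [|k /= ->]; rewrite ?muln0 // mulnS addnC.
Qed.

Lemma rec_exp n m b : rec n b -> rec n (fun v => m ^ b v).
Proof.
move=> recb.
have recS : rec n.+2 (fun w => m * nth 0 w 1).
  by apply: rec_mul; [apply: rec_const|apply: rec_var].
apply: eq_rec (rec_nat_rect (G := fun _ r v => m * r) (rec_const n 1) recS recb).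
by move=> v _; elim: (b v) => [|k /= ->]; rewrite ?expn0 ?expnS.
Qed.

Lemma rec_pred n a : rec n a -> rec n (fun v => (a v).-1).
Proof.
move=> reca.
apply: eq_rec (rec_nat_rect (G := fun k _ _ => k) (rec_zero n) (rec_var _ 0) reca).
by move=> v _; case: (a v).
Qed.

Lemma rec_sub n a b : rec n a -> rec n b -> rec n (fun v => a v - b v).
Proof.
move=> reca recb.
have recS : rec n.+2 (fun w => (nth 0 w 1).-1) by apply/rec_pred/rec_var.
apply: eq_rec (rec_nat_rect (G := fun _ r _ => r.-1) reca recS recb) => v _.
by elim: (b v) => [|k /= ->]; rewrite ?subn0 ?subnS.
Qed.

(** * Decidable predicates and bounded search *)

Lemma rec_leq n a b : rec n a -> rec n b -> rec n (fun v => a v <= b v : nat).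
Proof.
move=> reca recb.
apply: eq_rec (rec_sub (rec_const n 1) (rec_sub reca recb)) => v _.
by rewrite /leq; case: (a v - b v).
Qed.

Lemma rec_andb n (a b : seq nat -> bool) :
  rec n a -> rec n b -> rec n (fun v => a v && b v : nat).
Proof.
move=> reca recb; apply: eq_rec (rec_mul reca recb) => v _.
by case: (a v); case: (b v).
Qed.

Lemma rec_negb n (a : seq nat -> bool) :
  rec n a -> rec n (fun v => ~~ a v : nat).
Proof.
move=> reca; apply: eq_rec (rec_sub (rec_const n 1) reca) => v _.
by case: (a v).
Qed.

Lemma rec_orb n (a b : seq nat -> bool) :
  rec n a -> rec n b -> rec n (fun v => a v || b v : nat).
Proof.
move=> reca recb.
apply: eq_rec (rec_negb (rec_andb (rec_negb reca) (rec_negb recb))) => v _.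
by rewrite negb_and !negbK.
Qed.

Lemma rec_eq n a b : rec n a -> rec n b -> rec n (fun v => a v == b v : nat).
Proof.
move=> reca recb.
apply: eq_rec (rec_andb (rec_leq reca recb) (rec_leq recb reca)) => v _.
by rewrite -eqn_leq.
Qed.

Lemma rec_if n (b : seq nat -> bool) x y :
  rec n b -> rec n x -> rec n y -> rec n (fun v => if b v then x v else y v).
Proof.
move=> recb recx recy.
apply: eq_rec (rec_add (rec_mul recb recx) (rec_mul (rec_negb recb) recy)) => v _.
by case: (b v); rewrite /= ?mul1n ?mul0n ?addn0.
Qed.

(** The search is a primitive recursion: the accumulator equals the counter until the first hit,
    then falls behind it and stays fixed. *)
Lemma rec_find n (P : nat -> seq nat -> bool) B :
  rec n.+1 (fun w => P (nth 0 w 0) (behead w)) -> rec n B ->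
  rec n (fun v => find (P^~ v) (iota 0 (B v))).
Proof.
move=> recP recB.
have recS : rec n.+2 (fun w => nth 0 w 1 +
    (nth 0 w 1 == nth 0 w 0) && ~~ P (nth 0 w 0) (behead (behead w))).
  apply: rec_add; first exact: rec_var.
  apply: rec_andb; first by apply: rec_eq; apply: rec_var.
  apply: rec_negb.
  pose L w := nth 0 w 0 :: behead (behead w).
  apply: (rec_comp (L := L)) recP _ _ => [w|[|i] _]; last 2 first.
  - exact: rec_var.
  - by apply: eq_rec (rec_var _ i.+2) => w _; rewrite /= !nth_behead.
  - by rewrite /= !size_behead => ->.
apply: eq_rec (rec_nat_rect (G := fun k r v => r + (r == k) && ~~ P k v)
  (rec_zero n) recS recB) => v _.
elim: (B v) => [//|k IHk].
rewrite [LHS]/= IHk -[k.+1]addn1 iotaD add0n find_cat has_find size_iota /=.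
case: ltngtP => [ltfk|ltkf|->]; rewrite ?addn0 //=.
  by have := find_size (P^~ v) (iota 0 k); rewrite size_iota leqNgt ltkf.
by case: (P k v).
Qed.

Lemma rec_has n (P : nat -> seq nat -> bool) B :
  rec n.+1 (fun w => P (nth 0 w 0) (behead w)) -> rec n B ->
  rec n (fun v => has (P^~ v) (iota 0 (B v)) : nat).
Proof.
move=> recP recB.
apply: eq_rec (rec_leq (rec_succ (rec_find recP recB)) recB) => v _.
by rewrite has_find size_iota.
Qed.

(** The case [y = s] is the default of a failed search, hence the guard on [P y]. *)
Lemma find_iota_eq (P : pred nat) s y :
  y <= s -> (y < s -> P y) -> (forall z, z < y -> ~~ P z) ->
  find P (iota 0 s) = y.
Proof.
move=> leys Py Pz; rewrite -(subnKC leys) iotaD find_cat add0n.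
have /negPf-> : ~~ has P (iota 0 y).
  by rewrite -all_predC; apply/allP => z; rewrite mem_iota => /= /Pz.
rewrite size_iota; case: (s - y) (subnKC leys) => [|d] /=; first by rewrite addn0.
by move=> eqs; rewrite Py ?addn0 // -eqs; lia.
Qed.

Lemma find_iota_before (P : pred nat) s z :
  z < find P (iota 0 s) -> ~~ P z.
Proof.
move=> ltz; have ltzs : z < s.
  by have := find_size P (iota 0 s); rewrite size_iota; apply: leq_trans.
by have := before_find 0 ltz; rewrite nth_iota // add0n => ->.
Qed.

Lemma computableP f : computable f <-> rec 1 (fun v => f (nth 0 v 0)).
Proof.
split=> -[c cf]; exists c; last by move=> x; apply: cf.
by move=> v; case/tupleP: v => x v; rewrite (tuple0 v); apply: cf.
Qed.

Lemma computable2P f : computable2 f <-> rec 2 (fun v => f (nth 0 v 0) (nth 0 v 1)).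
Proof.
split=> -[c cf]; exists c; last by move=> x y; apply: cf.
move=> v; case/tupleP: v => x v; case/tupleP: v => y v; rewrite (tuple0 v).
have := cf x y.
suff -> : [tuple x; y] = [tuple of x :: [tuple of y :: [tuple]]] by [].
exact: val_inj.
Qed.

(** * Step-bounded evaluation *)

(* [ev c s v] is [y.+1] if [s] bounds every unbounded search in a computation
   of [c] on [v] with value [y], and 0 if there is no such computation. *)
Fixpoint ev n (c : recfun n) (s : nat) (v : seq nat) : nat :=
  match c with
  | Zero _ => 1
  | Succ => (nth 0 v 0).+2
  | Proj _ i => (nth 0 v i).+1
  | Comp m _ f g =>
      if all (fun i => 0 < ev (g i) s v) (enum 'I_m)
      then ev f s [seq (ev (g i) s v).-1 | i <- enum 'I_m] else 0
  | Prec _ f g =>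
      nat_rect (fun=> nat) (ev f s (behead v))
        (fun k r => if 0 < r then ev g s [:: k, r.-1 & behead v] else 0)
        (nth 0 v 0)
  | Mu _ f =>
      let y := find (fun z => ev f s (z :: v) <= 1) (iota 0 s) in
      if ev f s (y :: v) == 1 then y.+1 else 0
  end.

(** The test [<= 1] stops at a zero of [f], but also at a computation that [s] does not bound, which
    the final test for 1 rejects. A failed search returns [s], which is then tested itself; hence
    [y <= s]. *)
Lemma ev_MuP n (f : recfun n.+1) s v y :
  ev (Mu f) s v = y.+1 <->
  [/\ y <= s, ev f s (y :: v) = 1 & forall z, z < y -> 1 < ev f s (z :: v)].
Proof.
split=> /=.
  set y0 := find _ _; case: eqP => // fy0 [<-]; split=> // [|z].
    by rewrite -[leqRHS](size_iota 0) find_size.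
  by move/find_iota_before; rewrite -ltnNge.
move=> [leys fy fz]; rewrite (@find_iota_eq _ _ y) ?fy //.
by move=> z /fz; rewrite -ltnNge.
Qed.

(** In the case of [Mu], all values before the result exceed 1, so they come from convergent
    computations, which a larger bound preserves. *)
Lemma ev_mono n (c : recfun n) s s' v y :
  s <= s' -> ev c s v = y.+1 -> ev c s' v = y.+1.
Proof.
move=> less'.
elim: c v y => {n} [//|//|//|m n f IHf g IHg|n f IHf g IHg|n f IHf] v y.
- rewrite /=; case: ifP => // /allP g_gt0 fy.
  have eqg i : ev (g i) s' v = ev (g i) s v.
    have := g_gt0 i (mem_enum _ _); case E: (ev (g i) s v) => [//|z] _.
    exact: IHg E.
  under eq_all do rewrite eqg; under eq_map do rewrite eqg.
  by rewrite ifT; [apply: IHf|apply/allP].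
- rewrite /=; elim: (nth 0 v 0) y => [|k IHk] y /=; first exact: IHf.
  case: ifP => // + gy; case: (nat_rect _ _ _ _) IHk gy => // z IHk gy _.
  by rewrite (IHk z) //=; apply: IHg.
- move=> /ev_MuP[leys fy fz]; apply/ev_MuP; split; first exact: leq_trans less'.
    exact: IHf.
  move=> z /fz; case E: (ev f s (z :: v)) => [|w] // gt1.
  by rewrite (IHf _ _ E).
Qed.

Lemma forall_exists_bound m (P : nat -> nat -> Prop) :
  (forall i s s', s <= s' -> P i s -> P i s') ->
  (forall i, i < m -> exists s, P i s) -> exists s, forall i, i < m -> P i s.
Proof.
move=> Pmono; elim: m => [|m IHm] exP; first by exists 0.
have [|s sP] := IHm; first by move=> i /ltnW; apply: exP.
have [t tP] := exP m (ltnSn m).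
exists (maxn s t) => i; rewrite ltnS leq_eqVlt => /orP[/eqP->|/sP].
  by apply: Pmono tP; rewrite leq_maxr.
by apply: Pmono; rewrite leq_maxl.
Qed.

Lemma ev_sound n (c : recfun n) s (v : n.-tuple nat) y :
  ev c s v = y.+1 -> eval c v y.
Proof.
elim: c v y => {n} [n||n i|m n f IHf g IHg|n f IHf g IHg|n f IHf] v y.
- by move=> /= [<-].
- by move=> /= [<-]; rewrite /thead (tnth_nth 0).
- by move=> /= [<-]; rewrite (tnth_nth 0).
- rewrite /=; case: ifP => // /allP g_gt0.
  set w := map _ _ => fy.
  have szw : size w == m by rewrite size_map size_enum_ord.
  exists (Tuple szw); split; last exact: (IHf (Tuple szw)).
  move=> i; apply: IHg; rewrite (tnth_nth 0) /= (nth_map i) ?size_enum_ord //.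
  by rewrite nth_ord_enum prednK // g_gt0 ?mem_enum.
- have -> : ev (Prec f g) s v = nat_rect (fun=> nat) (ev f s (behead v))
      (fun k r => if 0 < r then ev g s [:: k, r.-1 & behead v] else 0)
      (thead v).
    by rewrite /thead (tnth_nth 0).
  rewrite /=; elim: (thead v) y => [|k IHk] y /=.
    exact: (IHf [tuple of behead v]).
  case: ifP => // + gy; case E: (nat_rect _ _ _ _) gy => [//|z] gy _.
  exists z; split; first exact: IHk.
  exact: (IHg [tuple of k :: z :: [tuple of behead v]]).
- move=> /ev_MuP[leys fy fz]; split; first exact: (IHf [tuple of y :: v]).
  move=> z /fz; case E: (ev f s (z :: v)) => [|[|u]] // _.
  by exists u; apply: (IHf [tuple of z :: v]).
Qed.

Lemma ev_complete n (c : recfun n) (v : n.-tuple nat) y :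
  eval c v y -> exists s, ev c s v = y.+1.
Proof.
elim: c v y => {n} [n||n i|m n f IHf g IHg|n f IHf g IHg|n f IHf] v y.
- by move=> /= ->; exists 0.
- by move=> /= ->; exists 0; rewrite /= /thead (tnth_nth 0).
- by move=> /= ->; exists 0; rewrite (tnth_nth 0).
- move=> [w [gw /IHf[s fw]]].
  have [|j ltjm|t gt] := @forall_exists_bound m (fun j t => forall ltjm : j < m,
      ev (g (Ordinal ltjm)) t v = (nth 0 w j).+1).
  + by move=> j t t' lett' gt ltjm; apply: ev_mono (gt ltjm).
  + have [t gt] := IHg _ _ _ (gw (Ordinal ltjm)).
    exists t => ltjm'; rewrite -(tnth_nth 0 w (Ordinal ltjm)) -gt.
    by rewrite (bool_irrelevance ltjm ltjm').
  have {}gt i : ev (g i) (maxn s t) v = (nth 0 w i).+1.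
    by apply: ev_mono (leq_maxr s t) _; case: i => i ltim; apply: gt.
  exists (maxn s t); rewrite /=.
  under eq_all do rewrite gt; under eq_map do rewrite gt /=.
  rewrite all_predT; apply: ev_mono (leq_maxl s t) _; rewrite -fw; congr ev.
  have -> : [seq nth 0 w (val i) | i <- enum 'I_m] = mkseq (nth 0 w) (size w).
    by rewrite map_comp val_enum_ord size_tuple.
  exact: mkseq_nth.
- have evE s : ev (Prec f g) s v = nat_rect (fun=> nat) (ev f s (behead v))
      (fun k r => if 0 < r then ev g s [:: k, r.-1 & behead v] else 0)
      (thead v).
    by rewrite /thead (tnth_nth 0).
  move=> ey; suff [s sP] : exists s, nat_rect (fun=> nat) (ev f s (behead v))
      (fun k r => if 0 < r then ev g s [:: k, r.-1 & behead v] else 0)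
      (thead v) = y.+1 by exists s; rewrite evE.
  move: ey; rewrite /=; elim: (thead v) y => [|k IHk] y /=; first exact: IHf.
  move=> [z [/IHk[s sP] /IHg[t tP]]]; exists (maxn s t).
  (* The recursion up to [k] is itself the evaluation of [Prec f g] at [k :: behead v], so [ev_mono]
     applies to it. *)
  suff -> : nat_rect (fun=> nat) (ev f (maxn s t) (behead v))
      (fun k r => if 0 < r then ev g (maxn s t) [:: k, r.-1 & behead v] else 0)
      k = z.+1 by rewrite /=; apply: ev_mono tP; apply: leq_maxr.
  have := @ev_mono _ (Prec f g) _ (maxn s t) (k :: behead v) z (leq_maxl s t).
  exact.
- move=> [/IHf[s fy] fz].
  have [|z /fz[u /IHf[t tP]]|t tP] := @forall_exists_bound y
      (fun z t => 1 < ev f t (z :: v)).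
  + move=> z t t' lett'; case E: (ev f t (z :: v)) => [|u] // gt1.
    by rewrite (ev_mono lett' E).
  + by exists t; rewrite tP.
  exists (maxn y (maxn s t)); apply/ev_MuP; split; first exact: leq_maxl.
    by apply: ev_mono fy; lia.
  move=> z /tP; case E: (ev f t (z :: v)) => [|u] // gt1.
  by rewrite (ev_mono _ E) //; lia.
Qed.

(** * Recursiveness of the step-bounded evaluation *)

Lemma rec_all (I : Type) (l : seq I) n (b : I -> seq nat -> bool) :
  (forall i, rec n (b i)) -> rec n (fun v => all (b^~ v) l).
Proof.
move=> recb; elim: l => [|i l IHl] /=; first exact: (rec_const n 1).
exact: rec_andb.
Qed.

(** The code is fixed and serves only for the induction, so neither a numbering of codes nor a
    universal function enters. *)
Lemma rec_ev n (c : recfun n) : rec n.+1 (fun w => ev c (nth 0 w 0) (behead w)).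
Proof.
elim: c => {n} [n||n i|m n f IHf g IHg|n f IHf g IHg|n f IHf] /=.
- exact: (rec_const _ 1).
- exact: rec_succ (rec_succ (rec_behead (rec_var 1 0))).
- exact: rec_succ (rec_behead (rec_var n i)).
- apply: rec_if; last exact: rec_zero.
    by apply: rec_all => i; exact: rec_leq (rec_const _ 1) (IHg i).
  pose L w := nth 0 w 0 ::
    [seq (ev (g i) (nth 0 w 0) (behead w)).-1 | i <- enum 'I_m].
  apply: (rec_comp (L := L)) IHf _ _ => [w _|[|j] ltj].
  + by rewrite /= size_map size_enum_ord.
  + exact: rec_var.
  + apply: eq_rec (rec_pred (IHg (Ordinal (ltj : j < m)))) => w _ /=.
    rewrite (nth_map (Ordinal (ltj : j < m))) ?size_enum_ord //.
    by rewrite (nth_ord_enum _ (Ordinal (ltj : j < m))).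
- apply: (rec_nat_rect (n := n.+2) (F := fun w => ev f (nth 0 w 0) (behead (behead w)))
    (G := fun k r w => if 0 < r then
      ev g (nth 0 w 0) [:: k, r.-1 & behead (behead w)] else 0)).
  + pose L w := nth 0 w 0 :: behead (behead w).
    apply: (rec_comp (L := L)) IHf _ _ => [w|[|j] _].
    * by rewrite /= !size_behead => ->.
    * exact: rec_var.
    * exact: rec_behead (rec_behead (rec_var _ j)).
  + apply: rec_if; last exact: rec_zero.
      exact: rec_leq (rec_const _ 1) (rec_var _ 1).
    (* Here [w] is [k :: r :: s :: v]; dropping four entries also removes the head of [v], the
       original recursion argument. *)
    pose L w := [:: nth 0 w 2, nth 0 w 0, (nth 0 w 1).-1 & drop 4 w].
    have recL : rec n.+4 (fun w => ev g (nth 0 (L w) 0) (behead (L w))).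
      apply: (rec_comp (L := L)) IHg _ _ => [w|[|[|[|j]]] _].
      * by rewrite /= size_drop => ->; rewrite subSS subSS subSS subSS subn0.
      * exact: rec_var.
      * exact: rec_var.
      * exact: rec_pred (rec_var _ 1).
      * by apply: eq_rec (rec_var _ j.+4) => w _; rewrite /= nth_drop.
    by apply: eq_rec recL => -[|a [|b [|c [|d w]]]] //= _; rewrite drop0.
  + exact: rec_behead (rec_var _ 0).
- pose H w := ev f (nth 0 w 1) (nth 0 w 0 :: behead (behead w)).
  have recH : rec n.+2 H.
    pose L w := [:: nth 0 w 1, nth 0 w 0 & behead (behead w)].
    apply: (rec_comp (L := L)) IHf _ _ => [w|[|[|j]] _].
    + by rewrite /= !size_behead => ->.
    + exact: rec_var.
    + exact: rec_var.
    + exact: rec_behead (rec_behead (rec_var _ j)).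
  pose Y w := find (fun z => ev f (nth 0 w 0) (z :: behead w) <= 1)
    (iota 0 (nth 0 w 0)).
  have recY : rec n.+1 Y.
    apply: (@rec_find n.+1
      (fun z w => ev f (nth 0 w 0) (z :: behead w) <= 1)); last exact: rec_var.
    apply: rec_leq (rec_const _ 1).
    by apply: eq_rec recH => w _; rewrite /H nth_behead.
  have recHY := rec_cons recH recY.
  exact: rec_if (rec_eq recHY (rec_const _ 1)) (rec_succ recY) (rec_zero _).
Qed.


(** [Mu] looks for zeros, so it is applied to the characteristic function of [T = 0], which vanishes
    exactly where [T] is positive. *)
Lemma mu_domain n T : rec n.+1 T ->
  exists c : recfun n, forall v : n.-tuple nat,
    (exists s, 0 < T (s :: v)) <-> exists y, eval c v y.
Proof.
move=> recT; have [c cP] := rec_eq recT (rec_zero n.+1).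
exists (Mu c) => v; split=> [exT|[y [cy _]]]; last first.
  exists y; rewrite lt0n.
  by have := eval_det cy (cP [tuple of y :: v]) => /=; case: (T _ == 0).
case: (ex_minnP exT) => y Ty miny; exists y; split.
  have := cP [tuple of y :: v]; rewrite /=.
  by rewrite (gtn_eqF Ty).
move=> z ltzy; exists 0; have := cP [tuple of z :: v]; rewrite /=.
suff -> : T (z :: v) == 0 by [].
by rewrite -leqn0 leqNgt; apply/negP => /miny; rewrite leqNgt ltzy.
Qed.

(** * Pairing *)

(** Since [a <= a + b], the value lies below [(a + b).+1 ^ 2], so it determines [a + b] and then
    [a]. *)
Definition code_pair a b := (a + b) ^ 2 + a.

Lemma code_pair_inj a b a' b' : code_pair a b = code_pair a' b' -> a = a' /\ b = b'.
Proof.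
rewrite /code_pair => eqp.
have eqs : a + b = a' + b' by case: (ltngtP (a + b) (a' + b')) => //; nia.
by move: eqp; rewrite eqs => /addnI eqa; move: eqs; rewrite eqa => /addnI.
Qed.

Lemma leq_pairl a b : a <= code_pair a b. Proof. exact: leq_addl. Qed.

Lemma leq_pairr a b : b <= code_pair a b. Proof. rewrite /code_pair; nia. Qed.

Definition unpair1 w :=
  find (fun a => has (fun b => code_pair a b == w) (iota 0 w.+1)) (iota 0 w.+1).

Definition unpair2 w :=
  find (fun b => has (fun a => code_pair a b == w) (iota 0 w.+1)) (iota 0 w.+1).

Lemma unpair1K a b : unpair1 (code_pair a b) = a.
Proof.
apply: find_iota_eq => [|_|z ltza].
- exact: leqW (leq_pairl a b).
- by apply/hasP; exists b => //; rewrite mem_iota ltnS leq_pairr.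
- by apply/hasPn => c _; apply/eqP => /code_pair_inj[eqz _]; rewrite eqz ltnn in ltza.
Qed.

Lemma unpair2K a b : unpair2 (code_pair a b) = b.
Proof.
apply: find_iota_eq => [|_|z ltzb].
- exact: leqW (leq_pairr a b).
- by apply/hasP; exists a => //; rewrite mem_iota ltnS leq_pairl.
- by apply/hasPn => c _; apply/eqP => /code_pair_inj[_ eqz]; rewrite eqz ltnn in ltzb.
Qed.

Lemma rec_code_pair n a b : rec n a -> rec n b -> rec n (fun v => code_pair (a v) (b v)).
Proof.
move=> reca recb; have recab := rec_add reca recb.
exact: rec_add (rec_mul recab recab) reca.
Qed.

Lemma rec_unpair1 n a : rec n a -> rec n (fun v => unpair1 (a v)).
Proof.
apply: (@rec_app1 n (fun v => unpair1 (nth 0 v 0))).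
apply: (@rec_find 1 (fun a v =>
  has (fun b => code_pair a b == nth 0 v 0) (iota 0 (nth 0 v 0).+1)))
  (rec_succ (rec_var 1 0)).
apply: (@rec_has 2 (fun b v => code_pair (nth 0 v 0) b == nth 0 (behead v) 0)).
  apply: rec_eq (rec_behead (rec_behead (rec_var 1 0))).
  exact: rec_code_pair (rec_behead (rec_var 2 0)) (rec_var 3 0).
exact: rec_succ (rec_behead (rec_var 1 0)).
Qed.

Lemma rec_unpair2 n a : rec n a -> rec n (fun v => unpair2 (a v)).
Proof.
apply: (@rec_app1 n (fun v => unpair2 (nth 0 v 0))).
apply: (@rec_find 1 (fun b v =>
  has (fun a => code_pair a b == nth 0 v 0) (iota 0 (nth 0 v 0).+1)))
  (rec_succ (rec_var 1 0)).
apply: (@rec_has 2 (fun a v => code_pair a (nth 0 v 0) == nth 0 (behead v) 0)).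
  apply: rec_eq (rec_behead (rec_behead (rec_var 1 0))).
  exact: rec_code_pair (rec_var 3 0) (rec_behead (rec_var 2 0)).
exact: rec_succ (rec_behead (rec_var 1 0)).
Qed.

(** * Blocks and columns *)

(** Block [j] runs from [4 ^ j] to below [4 ^ j.+1]; the default value of [trunc_log] puts 0 into
    block 0. *)
Definition block x := trunc_log 4 x.
Definition column x := unpair2 (block x).

Lemma ltn_block x j : block x < j -> x < 4 ^ j.
Proof.
move=> ltxj; apply: leq_trans (trunc_log_ltn x (isT : 1 < 4)) _.
by rewrite leq_exp2l.
Qed.

Lemma block_eq j i : i < 3 * 4 ^ j -> block (4 ^ j + i) = j.
Proof. by move=> lti; apply: trunc_log_eq => //; rewrite expnS; lia. Qed.

Lemma rec_block n a : rec n a -> rec n (fun v => block (a v)).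
Proof.
apply: (@rec_app1 n (fun v => block (nth 0 v 0))).
have recP : rec 2 (fun w => nth 0 (behead w) 0 < 4 ^ (nth 0 w 0).+1).
  apply: rec_leq; first exact: rec_succ (rec_behead (rec_var 1 0)).
  exact/rec_exp/rec_succ/rec_var.
apply: eq_rec (rec_find (P := fun k v => nth 0 v 0 < 4 ^ k.+1) recP (rec_var 1 0)).
move=> v _; move: (nth 0 v 0) => x; apply: find_iota_eq => [|_|k].
- case: x => [|x]; first by rewrite /block trunc_log0.
  apply: leq_trans (ltnW (ltn_expl _ (isT : 1 < 4))) _.
  exact: trunc_logP.
- exact: trunc_log_ltn.
- rewrite /block -leqNgt; case: x => [|x]; first by rewrite trunc_log0.
  by move=> ltk; rewrite (leq_trans _ (trunc_logP (isT : 1 < 4) (ltn0Sn x))) ?leq_exp2l.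
Qed.

Definition functional (F : nat -> nat -> nat -> Prop) :=
  forall e x z z', F e x z -> F e x z' -> z = z'.

(* The set C, with [F e x z] standing for F_e(x) = z. *)
Definition spread (F : nat -> nat -> nat -> Prop) (z : nat) : Prop :=
  exists x, [/\ F (unpair1 (block x)) x z, column x <> column z & block x <= block z].

Definition code_set F (A : set nat) : set nat :=
  fun z => spread F z \/ A (column z).

(* Block [j] has [3 * 4 ^ j] elements.  Those in [spread F] are values of [F] at
   points of earlier blocks, so there are at most [4 ^ j] of them, and at most
   [4 ^ j] are sent by [p] into earlier blocks. *)
Lemma block_escape F j p : functional F -> injective p ->
  exists x, [/\ block x = j, ~ spread F x & j <= block (p x)].
Proof.
move=> Ffun pinj; apply: contrapT => nox.
(* Otherwise each point of the block gets a label below [4 ^ j]: a point of an earlier block with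
   this value under [F], or its own image under [p]. Labels are injective, by functionality of [F]
   and injectivity of [p], but only [2 * 4 ^ j] are available. *)
have bad (i : 'I_(3 * 4 ^ j)) : exists r : 'I_(4 ^ j) + 'I_(4 ^ j),
    match r with
    | inl x => F (unpair1 (block x)) x (4 ^ j + i)
    | inr y => p (4 ^ j + i) = y
    end.
  have blk := block_eq (ltn_ord i); set z := 4 ^ j + i in blk *.
  have [|ltpz] := leqP j (block (p z)); last first.
    by exists (inr (Ordinal (ltn_block ltpz))).
  move=> lejp; have [x [Fx colx lex]] : spread F z.
    by apply: contrapT => nsz; apply: nox; exists z.
  suff ltx : block x < j by exists (inl (Ordinal (ltn_block ltx))).
  (* Points of one block share their column, so the column condition in [spread] makes the
     inequality of blocks strict. *)
  rewrite -blk ltn_neqAle lex andbT; apply/eqP => eqb.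
  by apply: colx; rewrite /column eqb.
have [r rP] := choice bad.
have rinj : injective r.
  move=> i i' eqr; have := rP i; have := rP i'; rewrite -eqr.
  case: (r i) => y; [move=> Fi' Fi; have := Ffun _ _ _ _ Fi Fi'|].
    by move=> /addnI/val_inj.
  by move=> <- /pinj/addnI/val_inj.
have := leq_card r rinj; rewrite card_sum !card_ord.
have := expn_gt0 4 j; lia.
Qed.

(** This is one half of the argument: a permutation yields one inclusion, and its inverse will yield
    the other. *)
Lemma code_set_transfer F (A B : set nat) e n p : functional F ->
  injective p -> (forall x, F e x (p x)) ->
  (forall x, code_set F B (p x) -> code_set F A x) -> B n -> A n.
Proof.
move=> Ffun pinj Fp BA Bn; apply: contrapT => nAn.
have [x [blkx nsx lejp]] := block_escape (code_pair e n) Ffun pinj.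
have colx : column x = n by rewrite /column blkx unpair2K.
have [|//|] := BA x; last by rewrite colx.
(* In both cases [p x] is in the code of [B]: through its column if that is [n], and otherwise
   because [x] itself puts it into [spread F]. *)
have [eqn|neqn] := pselect (column (p x) = n); first by right; rewrite eqn.
left; exists x; rewrite blkx unpair1K colx; split=> //.
by move=> eqn; apply: neqn.
Qed.

(** * Uniformization of the uniformly c.e. sequence *)

Section Uniformization.

Variable u : recfun 2.

(** The set enumerated by [u] at index [e] is read as a set of pairs, and [t] as a candidate value
    paired with a step bound. *)
Let witness t e x := 0 < ev u (unpair2 t) [:: e; code_pair x (unpair1 t)].

(** Taking the least witness makes a partial function out of any c.e. relation; the result is
    shifted by one, with 0 for no witness up to [s]. *)
Definition select s e x :=
  let t := find (fun t => witness t e x) (iota 0 s) in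
  if witness t e x then (unpair1 t).+1 else 0.

Lemma selectP s e x z : select s e x = z.+1 <->
  exists t, [/\ t <= s, witness t e x, forall t', t' < t -> ~~ witness t' e x
    & unpair1 t = z].
Proof.
rewrite /select; split=> [|[t [lets wt wt' <-]]].
  set t := find _ _; case: ifP => // wt [<-]; exists t; split=> // [|t'].
    by rewrite -[leqRHS](size_iota 0) find_size.
  exact: find_iota_before.
by rewrite (@find_iota_eq _ _ t) ?wt.
Qed.

Lemma select_mono s s' e x z :
  s <= s' -> select s e x = z.+1 -> select s' e x = z.+1.
Proof.
move=> less' /selectP[t [lets wt wt' lt]]; apply/selectP; exists t; split=> //.
exact: leq_trans less'.
Qed.

Definition selected e x z := exists s, select s e x = z.+1.

Lemma selected_functional : functional selected.
Proof.
move=> e x z z' [s sz] [s' s'z']; apply/eq_add_S; rewrite -sz -s'z'.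
have [le|le] := leqP s s'; first by rewrite sz (select_mono le sz).
by rewrite s'z' (select_mono (ltnW le) s'z').
Qed.

Lemma rec_select n a b c : rec n a -> rec n b -> rec n c ->
  rec n (fun v => select (a v) (b v) (c v)).
Proof.
apply: (@rec_app3 n (fun v => select (nth 0 v 0) (nth 0 v 1) (nth 0 v 2))).
have recw m t e x : rec m t -> rec m e -> rec m x ->
    rec m (fun v => witness (t v) (e v) (x v)).
  move=> rect rece recx; apply: rec_leq (rec_const m 1) _.
  apply: rec_app3 (rec_ev u) (rec_unpair2 rect) rece _.
  exact: rec_code_pair recx (rec_unpair1 rect).
pose Y v := find (fun t => witness t (nth 0 v 1) (nth 0 v 2)) (iota 0 (nth 0 v 0)).
have recY : rec 3 Y.
  apply: (@rec_find 3 (fun t v => witness t (nth 0 v 1) (nth 0 v 2)))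
    (rec_var 3 0).
  exact: recw (rec_var 4 0) (rec_behead (rec_var 3 1)) (rec_behead (rec_var 3 2)).
apply: rec_if (rec_succ (rec_unpair1 recY)) (rec_zero 3).
exact: recw recY (rec_var 3 1) (rec_var 3 2).
Qed.

Variable W : nat -> set nat.
Hypothesis Wu : forall e x, W e x <-> exists y, eval u [tuple e; x] y.

Lemma uniform_evP e x : W e x <-> exists s, 0 < ev u s [:: e; x].
Proof.
rewrite Wu; split=> [[y /ev_complete[s us]]|[s]].
  by exists s; rewrite us.
case E: (ev u s _) => [//|y] _; exists y; exact: (@ev_sound _ u s [tuple e; x]).
Qed.

(** An index of the graph of a computable function thus makes this function one of the F_e: every
    witness carries the right value, and one exists. *)
Lemma selected_graph e x y :
  (forall z, W e (code_pair x z) <-> z = y) -> selected e x y.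
Proof.
move=> Wy; have /uniform_evP[s us] : W e (code_pair x y) by apply/Wy.
have exw : exists t, witness t e x.
  by exists (code_pair y s); rewrite /witness unpair1K unpair2K.
case: (ex_minnP exw) => t wt mint; exists t; apply/selectP; exists t; split=> //.
  by move=> t'; apply: contraTN => /mint; rewrite -leqNgt.
by apply/Wy/uniform_evP; exists (unpair2 t).
Qed.

Lemma ce2_code_set : ce2 (fun i => code_set selected (W i)).
Proof.
(* In [w], read as [[:: s; i; z]], the single stage [s] bounds the evaluation, the selection and the
   candidates [x]. *)
pose T w := (0 < ev u (nth 0 w 0) [:: nth 0 w 1; column (nth 0 w 2)]) ||
  has (fun x => [&& select (nth 0 w 0) (unpair1 (block x)) x == (nth 0 w 2).+1,
    column x != column (nth 0 w 2) & block x <= block (nth 0 w 2)])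
    (iota 0 (nth 0 w 0)).
have recT : rec 3 (fun w => T w).
  apply: rec_orb.
    apply: rec_leq (rec_const 3 1) _.
    apply: rec_app3 (rec_ev u) (rec_var 3 0) (rec_var 3 1) _.
    exact/rec_unpair2/rec_block/rec_var.
  apply: (@rec_has 3 (fun x w =>
    [&& select (nth 0 w 0) (unpair1 (block x)) x == (nth 0 w 2).+1,
    column x != column (nth 0 w 2) & block x <= block (nth 0 w 2)])) (rec_var 3 0).
  have recv i : rec 4 (fun w => nth 0 (behead w) i) := rec_behead (rec_var 3 i).
  have recx := rec_var 4 0.
  apply: rec_andb; last apply: rec_andb.
  - apply: rec_eq (rec_succ (recv 2)).
    exact: rec_select (recv 0) (rec_unpair1 (rec_block recx)) recx.
  - apply/rec_negb/rec_eq; first exact: rec_unpair2 (rec_block recx).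
    exact: rec_unpair2 (rec_block (recv 2)).
  - exact: rec_leq (rec_block recx) (rec_block (recv 2)).
have [c cP] := mu_domain recT; exists c => i z.
rewrite -cP /T /=; split.
  move=> [[x [[s sx] /eqP colx lex]]|/uniform_evP[s us]]; last first.
    by exists s; rewrite us.
  (* The stage has to keep the selection made at [s] and to exceed [x]. *)
  exists (maxn s x.+1); rewrite lt0b; apply/orP; right; apply/hasP; exists x.
    by rewrite mem_iota; lia.
  by rewrite (select_mono (leq_maxl _ _) sx) eqxx colx.
move=> [s]; rewrite lt0b => /orP[us|/hasP[x _ /and3P[/eqP sx /eqP colx lex]]].
  by right; apply/uniform_evP; exists s.
by left; exists x; split=> //; exists s.
Qed.

End Uniformization.

(** * Indices of decidable sets, and the reduction *)

Lemma decidable_ce (D : pred nat) :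
  rec 1 (fun v => D (nth 0 v 0)) -> ce (fun x => D x).
Proof.
move=> recD; have [c cP] := mu_domain (rec_behead recD).
exists c => x; rewrite -cP /=; split=> [Dx|[_]]; first by exists 0; rewrite Dx.
by case: (D x).
Qed.

Lemma computable_act (G : computable_subgroup) g : computable (cg_act G g).
Proof.
apply/computableP; have /computable2P recG := cg_act_computable G.
exact: rec_app2 recG (rec_const 1 g) (rec_var 1 0).
Qed.

Lemma computable_id : computable id.
Proof. exact/computableP/rec_var. Qed.

Theorem theorem3p1 (W : nat -> set nat) (hW : standard_enumeration W) :
  exists f : nat -> nat,
    [/\ reduction (eq_ce W) (eq_ce W) f,
        forall i j : nat, W i <> W j ->
          ~ computably_isomorphic (W (f i)) (W (f j))
      & forall G : computable_subgroup, reduction (eq_ce W) (R_ce W G) f].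
Proof.
have [u Wu] := standard_uniform hW.
(* The s-m-n property gives [f]; the set [W (f i)] depends only on the set [W i], not on its
   index. *)
have [f compf Wf] := standard_smn hW (ce2_code_set Wu).
have index (D : pred nat) : rec 1 (fun v => D (nth 0 v 0)) ->
    exists e, forall w, W e w <-> D w.
  by move=> /decidable_ce/(standard_ceP hW)[e We]; exists e => w; rewrite We.
have noniso i j : W i <> W j -> ~ computably_isomorphic (W (f i)) (W (f j)).
  move=> neqW [p [/computableP recp [q pK qK] imp]]; apply: neqW.
  rewrite !Wf in imp.
  have [e We] := index (fun w => p (unpair1 w) == unpair2 w)
    (rec_eq (rec_app1 recp (rec_unpair1 (rec_var 1 0))) (rec_unpair2 (rec_var 1 0))).
  (* The graph of [q] is the graph of [p] with coordinates exchanged, so it is decidable from [p]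
     alone. *)
  have [e' We'] := index (fun w => p (unpair2 w) == unpair1 w)
    (rec_eq (rec_app1 recp (rec_unpair2 (rec_var 1 0))) (rec_unpair1 (rec_var 1 0))).
  have selp x : selected u e x (p x).
    apply: (selected_graph Wu) => z; rewrite We unpair1K unpair2K.
    by split=> [/eqP|->].
  have selq x : selected u e' x (q x).
    apply: (selected_graph Wu) => z; rewrite We' unpair1K unpair2K.
    by split=> [/eqP <-|->]; rewrite ?pK ?qK.
  (* The inverse [q] gives the inclusion of [W i] in [W j], and [p] the converse one. *)
  apply/seteqP; split=> n.
    apply: (code_set_transfer (@selected_functional u) (can_inj qK) selq).
    by move=> x; rewrite -[X in _ -> _ X]qK -imp => Aq; exists (q x).
  apply: (code_set_transfer (@selected_functional u) (can_inj pK) selp) => x.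
  by rewrite -imp => -[y Ay /(can_inj pK) <-].
have eqf i j : W i = W j -> W (f i) = W (f j) by move=> eqW; rewrite !Wf eqW.
exists f; split=> // [|G]; split=> // i j; split=> [eqW|].
- exact: eqf.
- move=> eqW; apply: contrapT => /noniso; apply; exists id.
  by split; [exact: computable_id|exists id|rewrite image_id].
- exists (cg_one G); first exact: cg_one_dom.
  rewrite (eqf _ _ eqW); apply/seteqP; split=> [x Wx|_ [x Wx <-]].
    by exists x => //; rewrite cg_act1.
  by rewrite cg_act1.
- move=> [g Gg eqW]; apply: contrapT => neqW.
  (* The indices are exchanged because [g] carries [W (f j)] to [W (f i)]. *)
  apply: (noniso j i); first by move=> /esym.
  exists (cg_act G g); split=> //; first exact: computable_act.
  exact: cg_act_bij.
Qed.
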